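(* Let $Q$ be a finite-dimensional real vector space, $\Delta_Q\subset TQ$ a constraint distribution of constant rank with annihilator $\Delta_Q^\circ\subset T^*Q$, $\Delta_Q^{\mathrm{d}\pm}\subset Q\times Q$ the associated discrete constraint distributions, and $N\ge 1$ an integer. (+) Let $H_{\mathrm{d}+}:Q\times Q^*\to\mathbb{R}$ be a smooth $(+)$-discrete Hamiltonian. If $\{q_k\}_{k=0}^N\subset Q$ and $\{p_{k+1}\}_{k=0}^{N-1}\subset Q^*$ satisfy the $(+)$-discrete Hamilton--d'Alembert principle in phase space $$\delta\sum_{k=0}^{N-1}\bigl[p_{k+1}q_{k+1}-H_{\mathrm{d}+}(q_k,p_{k+1})\bigr]=0,$$ then they satisfy the $(+)$-discrete nonholonomic Hamilton's equations $$(q_k,q_{k+1})\in\Delta_Q^{\mathrm{d}+},\qquad q_{k+1}=D_2H_{\mathrm{d}+}(q_k,p_{k+1})\qquad(0\le k\le N-1),$$ $$p_k-D_1H_{\mathrm{d}+}(q_k,p_{k+1})\in\Delta_Q^\circ(q_k)\qquad(1\le k\le N-1).$$ (−) Let $H_{\mathrm{d}-}:Q^*\times Q\to\mathbb{R}$ be a smooth $(-)$-discrete Hamiltonian. If $\{q_k\}_{k=0}^N\subset Q$ and $\{p_{k}\}_{k=0}^{N-1}\subset Q^*$ satisfy the $(-)$-discrete Hamilton--d'Alembert principle in phase space $$\delta\sum_{k=0}^{N-1}\bigl[-p_{k}q_{k}-H_{\mathrm{d}-}(p_k,q_{k+1})\bigr]=0,$$ then they satisfy the $(-)$-discrete nonholonomic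 Hamilton's equations $$(q_k,q_{k+1})\in\Delta_Q^{\mathrm{d}-},\qquad q_{k}=-D_1H_{\mathrm{d}-}(p_k,q_{k+1})\qquad(0\le k\le N-1),$$ $$p_{k+1}+D_2H_{\mathrm{d}-}(p_k,q_{k+1})\in\Delta_Q^\circ(q_{k+1})\qquad(0\le k\le N-2).$$
   Context: $T_qQ\cong Q$ and $T_q^*Q\cong Q^*$ since $Q$ is a vector space; $p\,q$ denotes the natural pairing of $p\in Q^*$ with $q\in Q$; $D_i$ is the partial derivative with respect to the $i$-th argument (a derivative with respect to a variable in $Q$ is an element of $Q^*$, and with respect to a variable in $Q^*$ an element of $Q^{**}\cong Q$). The annihilator of $\Delta_Q$ is $\Delta_Q^\circ(q)=\{\alpha_q\in T_q^*Q\mid\langle\alpha_q,v_q\rangle=0\text{ for all }v_q\in\Delta_Q(q)\}$, spanned by one-forms $\omega^1,\dots,\omega^m$, $m=\dim Q-\dim\Delta_Q(q)$. A retraction on $Q$ is a smooth map $\mathcal{R}:TQ\to Q$ whose restriction $\mathcal{R}_q$ to $T_qQ$ satisfies $\mathcal{R}_q(0_q)=q$ and $T_{0_q}\mathcal{R}_q=\mathrm{id}_{T_qQ}$ for all $q$; $\mathcal{R}_q^{-1}$ is its (local) inverse near $0_q$. With a fixed retraction, put $\omega^a_{\mathrm{d}+}(q_0,q_1):=\omega^a(q_0,\mathcal{R}_{q_0}^{-1}(q_1))$ and $\omega^a_{\mathrm{d}-}(q_0,q_1):=\omega^a(q_1,-\mathcal{R}_{q_1}^{-1}(q_0))$; then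 $\Delta_Q^{\mathrm{d}\pm}:=\{(q_0,q_1)\in Q\times Q\mid\omega^a_{\mathrm{d}\pm}(q_0,q_1)=0,\ a=1,\dots,m\}$. Meaning of the principles: the sequences satisfy the $(\pm)$-discrete Hamilton--d'Alembert principle in phase space if (1) the constraint $(q_k,q_{k+1})\in\Delta_Q^{\mathrm{d}\pm}$ holds for $k=0,\dots,N-1$ (with the sign $+$ or $-$ respectively), and (2) the first variation (the differential of the displayed sum, regarded as a function of all the variables $q_k$ and $p_{k+1}$, respectively $q_k$ and $p_k$, considered independent) vanishes on all variations such that $\delta q_0=\delta q_N=0$ and $\delta q_k\in\Delta_Q(q_k)$ for all $k$, while the variations $\delta p_{k+1}$ (respectively $\delta p_k$) are arbitrary. The constraint on $\delta q_k$ is imposed after taking the variations inside the sum (so variations are not required to be tangent to the constraint in (1)). *)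

(* Defs.v *)
From HB Require Import structures.
From mathcomp Require Import all_boot all_order all_algebra.
From mathcomp Require Import all_classical all_reals all_analysis.

Set Implicit Arguments.
Unset Strict Implicit.
Unset Printing Implicit Defensive.

Import Order.TTheory GRing.Theory Num.Theory.
Import numFieldNormedType.Exports.
Import VectorInternalTheory.

Local Open Scope classical_set_scope.
Local Open Scope ring_scope.

(* Calculus on a finite-dimensional real vector space V : vectType R.  The    *)
(* library gives V no topology; the one used here is transported from         *)
(* 'rV[R]_(dim V) along the linear isomorphism v2r (inverse r2v).  In finite  *)
(* dimension openness, continuity, differentiability and the differential do  *)
(* not depend on that choice of coordinates.                                  *)

Definition vopen (R : realType) (V : vectType R) (A : set V) : Prop :=
  open (@r2v R V @^-1` A).

Definition incoord (R : realType) (V W : vectType R) (f : V -> W)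
    (x : 'rV[R]_(dim V)) : 'rV[R]_(dim W) :=
  v2r (f (r2v x)).

Definition vcontinuous (R : realType) (V W : vectType R) (f : V -> W) : Prop :=
  continuous (incoord f).

Definition vdifferentiable (R : realType) (V W : vectType R) (f : V -> W)
    (x : V) : Prop :=
  differentiable (incoord f) (v2r x).

Definition vdiff (R : realType) (V W : vectType R) (f : V -> W) (x : V) :
    'Hom(V, W) :=
  linfun (@r2v R W \o 'd (incoord f) (v2r x) \o @v2r R V).

Lemma vdiffE (R : realType) (V W : vectType R) (f : V -> W) (x v : V) :
  vdiff f x v = r2v ('d (incoord f) (v2r x) (v2r v)).
Proof. by rewrite /vdiff lfunE. Qed.

Fixpoint Ck (R : realType) (k : nat) (V W : vectType R) (f : V -> W) : Prop :=
  match k with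
  | 0 => vcontinuous f
  | k'.+1 => (forall x, vdifferentiable f x) /\ Ck k' (vdiff f)
  end.

Definition smooth (R : realType) (V W : vectType R) (f : V -> W) : Prop :=
  forall k, Ck k f.

Notation covector V := 'Hom(V, _^o).

(* The canonical isomorphism of V with its bidual.                            *)
Definition ev (R : realType) (V : vectType R) (v : V) :
    covector (covector V) :=
  linfun (fun p : covector V => p v : R^o).

Lemma evE (R : realType) (V : vectType R) (v : V) (p : covector V) :
  ev v p = p v.
Proof.
have evl : linear (fun p : covector V => p v : R^o).
  by move=> a p1 p2; rewrite add_lfunE scale_lfunE.
pose evL := GRing.isLinear.Build _ _ _ _ _ evl.
pose evP : {linear 'Hom(V, R^o) -> R^o} :=
  HB.pack (fun p : 'Hom(V, R^o) => p v : R^o) evL.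
exact: (lfunE evP).
Qed.

(* Partial derivatives; each is a covector on the corresponding factor, so a  *)
(* derivative with respect to a covector variable lives in the bidual.        *)
Definition D1 (R : realType) (V W : vectType R) (f : V * W -> R^o)
    (x : V * W) : covector V :=
  vdiff (fun v => f (v, x.2)) x.1.

Definition D2 (R : realType) (V W : vectType R) (f : V * W -> R^o)
    (x : V * W) : covector W :=
  vdiff (fun w => f (x.1, w)) x.2.

Definition annihilator (R : realType) (V : vectType R) (U : {vspace V}) :
    set (covector V) :=
  [set alpha : covector V | forall v, v \in U -> alpha v = 0].

(* A constraint distribution of constant rank on Q, with the one-forms        *)
(* omega^1, ..., omega^m, m = dim Q - rank, spanning its annihilator.  The    *)
(* smoothness of the distribution is carried by that of the one-forms: being  *)
(* m in number they are pointwise independent, and the fibre at q is their    *)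
(* common kernel.                                                             *)
Record constraint_distribution (R : realType) (Q : vectType R) :=
  ConstraintDistribution {
  fiber :> Q -> {vspace Q};
  rank : nat;
  dim_fiber : forall q, \dim (fiber q) = rank;
  oneform : 'I_(\dim {:Q} - rank) -> Q -> covector Q;
  oneform_smooth : forall a, smooth (oneform a);
  oneform_span : forall q,
    annihilator (fiber q) =
      [set alpha | alpha \in <<[seq oneform a q | a : 'I__]>>%VS] }.
Arguments oneform {R Q} d a q : rename.

Record retraction (R : realType) (Q : vectType R) := Retraction {
  retr :> Q -> Q -> Q;
  retr_smooth : smooth (fun x : Q * Q => retr x.1 x.2);
  retr0 : forall q, retr q 0 = q;
  retr_diff0 : forall q, vdiff (retr q) 0 = \1%VF }.

(* For each q, a local inverse of the retraction at q near the zero vector,   *)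
(* defined on the image of the neighbourhood lsource q; its values outside    *)
(* this image are meaningless.                                                *)
Record local_inverse (R : realType) (Q : vectType R) (Rt : retraction Q) :=
  LocalInverse {
    lsource : Q -> set Q;
    linv : Q -> Q -> Q;
    lsource_open : forall q, vopen (lsource q);
    lsource0 : forall q, lsource q 0;
    ltarget_open : forall q, vopen (Rt q @` lsource q);
    linvK : forall q v, lsource q v -> linv q (Rt q v) = v }.

Definition ltarget (R : realType) (Q : vectType R) (Rt : retraction Q)
    (I : local_inverse Rt) (q : Q) : set Q :=
  Rt q @` lsource I q.

Section DiscreteConstraint.
Variables (R : realType) (Q : vectType R).
Variables (Delta : constraint_distribution Q).
Variables (Rt : retraction Q) (I : local_inverse Rt).

Definition omega_plus (a : 'I_(\dim {:Q} - rank Delta)) (q0 q1 : Q) : R :=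
  oneform Delta a q0 (linv I q0 q1).

Definition omega_minus (a : 'I_(\dim {:Q} - rank Delta)) (q0 q1 : Q) : R :=
  oneform Delta a q1 (- linv I q1 q0).

(* Membership includes that the local inverse is defined at the given point.  *)
Definition Delta_plus : set (Q * Q) :=
  [set x | ltarget I x.1 x.2 /\ forall a, omega_plus a x.1 x.2 = 0].

Definition Delta_minus : set (Q * Q) :=
  [set x | ltarget I x.2 x.1 /\ forall a, omega_minus a x.1 x.2 = 0].

End DiscreteConstraint.

(* Phase-space variables (q_0, ..., q_N) and N covectors: entry k of the      *)
(* second component is p_{k+1} in the (+) case and p_k in the (-) case.       *)
Definition phase (R : realType) (Q : vectType R) (N : nat) : vectType R :=
  ({ffun 'I_N.+1 -> Q} * {ffun 'I_N -> covector Q})%type.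

Section Principle.
Variables (R : realType) (Q : vectType R).
Variables (Delta : constraint_distribution Q).
Variables (Rt : retraction Q) (I : local_inverse Rt) (N : nat).

(* For k : 'I_N, the numbers k and k+1 as indices in 'I_N.+1.                 *)
Definition ord_this (k : 'I_N) : 'I_N.+1 := widen_ord (leqnSn N) k.
Definition ord_next (k : 'I_N) : 'I_N.+1 := lift ord0 k.

Definition action_plus (H : Q * covector Q -> R^o) (x : phase Q N) : R^o :=
  \sum_(k < N) (x.2 k (x.1 (ord_next k)) - H (x.1 (ord_this k), x.2 k)).

Definition action_minus (H : covector Q * Q -> R^o) (x : phase Q N) : R^o :=
  \sum_(k < N) (- x.2 k (x.1 (ord_this k)) - H (x.2 k, x.1 (ord_next k))).

Definition admissible_variation (q : nat -> Q) (d : phase Q N) : Prop :=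
  [/\ d.1 ord0 = 0, d.1 ord_max = 0 &
      forall k : 'I_N.+1, d.1 k \in Delta (q k)].

(* Only q_0, ..., q_N and the N covectors p_1, ..., p_N (resp.                *)
(* p_0, ..., p_{N-1}) of the sequences q and p are used below.                *)
Definition point_plus (q : nat -> Q) (p : nat -> covector Q) : phase Q N :=
  ([ffun k : 'I_N.+1 => q k], [ffun k : 'I_N => p k.+1]).

Definition point_minus (q : nat -> Q) (p : nat -> covector Q) : phase Q N :=
  ([ffun k : 'I_N.+1 => q k], [ffun k : 'I_N => p k]).

Definition Hamilton_dAlembert_plus (H : Q * covector Q -> R^o)
    (q : nat -> Q) (p : nat -> covector Q) : Prop :=
  (forall k, (k < N)%N -> Delta_plus Delta I (q k, q k.+1)) /\
  (forall d : phase Q N, admissible_variation q d ->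
     vdiff (action_plus H) (point_plus q p) d = 0).

Definition Hamilton_dAlembert_minus (H : covector Q * Q -> R^o)
    (q : nat -> Q) (p : nat -> covector Q) : Prop :=
  (forall k, (k < N)%N -> Delta_minus Delta I (q k, q k.+1)) /\
  (forall d : phase Q N, admissible_variation q d ->
     vdiff (action_minus H) (point_minus q p) d = 0).

End Principle.

(* Main.v *)
Require Import Defs.
From HB Require Import structures.
From mathcomp Require Import all_boot all_order all_algebra.
From mathcomp Require Import all_classical all_reals all_analysis.

(* Both discrete actions have the shape                                       *)
(*   sum_k (s p_k q_(a k) - G (q_(b k), p_k))                                 *)
(* with s = 1, G = H, (a k, b k) = (k+1, k) for (+), and with s = -1,         *)
(* (a k, b k) = (k, k+1) and G the Hamiltonian with its arguments exchanged   *)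
(* for (-).  Testing the first variation against a variation of a single      *)
(* covector gives s q_(a k) = D_2 G, and against a variation of a single      *)
(* interior point i = a k = b j, lying in the fibre, gives s p_k = D_1 G on   *)
(* the fibre.                                                                 *)

Set Implicit Arguments.
Unset Strict Implicit.
Unset Printing Implicit Defensive.

Import Order.TTheory GRing.Theory Num.Theory.
Import numFieldNormedType.Exports.
Import VectorInternalTheory.

Local Open Scope classical_set_scope.
Local Open Scope ring_scope.

(** The constraint on consecutive points is part of the principle; only the two equations need an
    argument. The action is a sum of pairings, bilinear in points and covectors, minus values of [G]
    at linear images of the phase point, so the product and chain rules split its differential into
    a sum over covector variations and a sum over point variations ([vdiff_action]). Covector
    variations are free, so each one yields an identity in the bidual ([momentum_stationary]). An
    interior point occurs in exactly one pairing and one value of [G]; moving it alone along its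
    fibre compares these two terms on the fibre ([position_stationary]), which is the annihilator
    condition. *)

(** * Differential calculus transported through coordinates *)

Lemma rowvec_linear_continuous (R : realType) n (W : normedModType R)
    (f : {linear 'rV[R]_n -> W}) : continuous f.
Proof.
have -> : (f : 'rV[R]_n -> W) =
    fun x => \sum_(i < n) x ord0 i *: f (delta_mx ord0 i).
  apply/funext => x; rewrite {1}[x]row_sum_delta linear_sum.
  by apply: eq_bigr => i _; rewrite linearZ.
elim: (index_enum 'I_n) => [|i r IHr] x.
  have -> : (fun x : 'rV[R]_n =>
      \sum_(i <- [::]) x ord0 i *: f (delta_mx ord0 i)) = cst 0.
    by apply/funext => y; rewrite big_nil.
  exact: cst_continuous.
have -> : (fun x : 'rV[R]_n =>
    \sum_(j <- i :: r) x ord0 j *: f (delta_mx ord0 j)) =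
  (fun x => x ord0 i *: f (delta_mx ord0 i)) \+
  (fun x => \sum_(j <- r) x ord0 j *: f (delta_mx ord0 j)).
  by apply/funext => y; rewrite big_cons.
apply: continuousD (IHr x); apply: continuousZr_tmp; exact: coord_continuous.
Qed.

Lemma rowvec_linear_is_diff (R : realType) n (W : normedModType R)
    (f : {linear 'rV[R]_n -> W}) x : is_diff x f f.
Proof.
have fc : continuous f by exact: rowvec_linear_continuous.
by apply: DiffDef; [exact: linear_differentiable | exact: diff_lin].
Qed.

(** Differentiability and the value of the differential are bundled, with [L] a bare function, so
    that the rules below compose without building linear maps. *)
Definition is_vdiff (R : realType) (V W : vectType R) (f : V -> W) (x : V)
    (L : V -> W) : Prop :=
  is_diff (v2r x) (incoord f) (v2r \o L \o r2v).

Lemma is_vdiff_vdiff (R : realType) (V W : vectType R) (f : V -> W) (x : V) :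
  vdifferentiable f x -> is_vdiff f x (vdiff f x).
Proof.
move=> fx; apply: is_diff_eq; first exact: differentiableP fx.
by apply/funext => u /=; rewrite vdiffE !r2vK.
Qed.

Section Calculus.
Variable R : realType.
Implicit Types U V W : vectType R.

Lemma vdiff_val V W (f : V -> W) x L : is_vdiff f x L -> vdiff f x =1 L.
Proof. by case=> _ dfx v; rewrite vdiffE dfx /= !v2rK. Qed.

Lemma is_vdiff_ext V W (f g : V -> W) x L M :
  f =1 g -> L =1 M -> is_vdiff f x L -> is_vdiff g x M.
Proof. by move=> /funext <- /funext <-. Qed.

Lemma is_vdiff_cst V W (c : W) (x : V) : is_vdiff (fun=> c) x (fun=> 0).
Proof.
apply: is_diff_eq; first exact: (is_diff_cst (v2r c)).
by apply/funext => u /=; rewrite linear0.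
Qed.

Lemma is_vdiff_lin V W (f : {linear V -> W}) x : is_vdiff f x f.
Proof.
exact: (rowvec_linear_is_diff (@v2r R W \o f \o @r2v R V)).
Qed.

Lemma is_vdiff_comp U V W (f : U -> V) (g : V -> W) x Lf Lg :
  is_vdiff f x Lf -> is_vdiff g (f x) Lg -> is_vdiff (g \o f) x (Lg \o Lf).
Proof.
move=> fx gfx.
have gfx' : is_diff (incoord f (v2r x)) (incoord g) (v2r \o Lg \o r2v).
  by rewrite /incoord v2rK.
have := is_diff_comp fx gfx'.
have -> : incoord g \o incoord f = incoord (g \o f).
  by apply/funext => u /=; rewrite /incoord v2rK.
by move/is_diff_eq; apply; apply/funext => u /=; rewrite v2rK.
Qed.

Lemma is_vdiffD V W (f g : V -> W) x Lf Lg :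
  is_vdiff f x Lf -> is_vdiff g x Lg ->
  is_vdiff (fun v => f v + g v) x (fun v => Lf v + Lg v).
Proof.
move=> fx gx; have := is_diffD fx gx.
have -> : incoord f + incoord g = incoord (fun v => f v + g v).
  by apply/funext => u; rewrite /incoord linearD.
by move/is_diff_eq; apply; apply/funext => u /=; rewrite linearD.
Qed.

Lemma is_vdiffZ V W (c : R) (f : V -> W) x L :
  is_vdiff f x L -> is_vdiff (fun v => c *: f v) x (fun v => c *: L v).
Proof.
move=> fx; have := is_diffZ c fx.
have -> : c *: incoord f = incoord (fun v => c *: f v).
  by apply/funext => u; rewrite /incoord linearZ.
by move/is_diff_eq; apply; apply/funext => u /=; rewrite linearZ.
Qed.

Lemma is_vdiff_sum V W (I : Type) (r : seq I) (f L : I -> V -> W) x :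
  (forall i, is_vdiff (f i) x (L i)) ->
  is_vdiff (fun v => \sum_(i <- r) f i v) x (fun v => \sum_(i <- r) L i v).
Proof.
move=> fx; elim: r => [|i r IHr].
  by apply: is_vdiff_ext (is_vdiff_cst 0 x) => v; rewrite big_nil.
by apply: is_vdiff_ext (is_vdiffD (fx i) IHr) => v; rewrite big_cons.
Qed.

(** Removes the coordinates on the target, so that the product rule for scalar functions becomes
    applicable. *)
Lemma is_vdiff_scalarP V (f : V -> R^o) x (L : V -> R^o) :
  is_vdiff f x L <-> is_diff (v2r x) (f \o r2v) (L \o r2v).
Proof.
split=> [fx|fx].
  have := is_diff_comp fx (@rowvec_linear_is_diff R _ R^o (@r2v R R^o) _).
  have -> : r2v \o incoord f = f \o r2v.
    by apply/funext => u /=; rewrite /incoord v2rK.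
  by move/is_diff_eq; apply; apply/funext => u /=; rewrite v2rK.
(* On the line, taking coordinates is scaling one fixed vector. *)
have vE (a : R^o) : v2r a = a *: v2r (1 : R^o) by rewrite -linearZ /= scaler1.
have := is_diff_comp fx (is_diff_scalel ((f \o r2v) (v2r x)) (v2r (1 : R^o))).
have -> : *:%R ^~ (v2r (1 : R^o)) \o (f \o r2v) = incoord f.
  by apply/funext => u /=; rewrite -vE.
by move/is_diff_eq; apply; apply/funext => u /=; rewrite -vE.
Qed.

Lemma is_vdiffM V (f g : V -> R^o) x (Lf Lg : V -> R^o) :
  is_vdiff f x Lf -> is_vdiff g x Lg ->
  is_vdiff (fun v => f v * g v : R^o) x (fun v => f x * Lg v + g x * Lf v).
Proof.
move=> /is_vdiff_scalarP fx /is_vdiff_scalarP gx; apply/is_vdiff_scalarP.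
have := is_diffM fx gx.
by move/is_diff_eq; apply; apply/funext => u /=; rewrite v2rK.
Qed.

Lemma is_vdiff_linear V W (f : V -> W) x : linear f -> is_vdiff f x f.
Proof.
move=> fl; pose fL := GRing.isLinear.Build _ _ _ _ _ fl.
pose fP : {linear V -> W} := HB.pack f fL.
exact: (is_vdiff_lin fP).
Qed.

(** Expanding [phi y] in the basis [e] turns the pairing into a finite sum of products of scalar
    linear functions, to which the Leibniz rule applies. *)
Lemma is_vdiff_pairing V W (pi : V -> covector W) (phi : V -> W) x :
  linear pi -> linear phi ->
  is_vdiff (fun y => pi y (phi y) : R^o) x
    (fun d => pi d (phi x) + pi x (phi d)).
Proof.
move=> pil phil.
pose e i : W := r2v (delta_mx ord0 i).
pose c i y : R^o := v2r (phi y) ord0 i.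
have pairE y z : pi y (phi z) = \sum_i c i z * pi y (e i).
  rewrite -[phi z]v2rK [v2r _]row_sum_delta !linear_sum.
  by apply: eq_bigr => i _; rewrite !linearZ.
have cl i : linear (c i).
  by move=> k y z; rewrite /c phil linearP !mxE.
have pel i : linear (fun y => pi y (e i) : R^o).
  by move=> k y z; rewrite pil add_lfunE scale_lfunE.
apply: is_vdiff_ext (is_vdiff_sum (index_enum _)
  (fun i => is_vdiffM (is_vdiff_linear x (cl i)) (is_vdiff_linear x (pel i)))).
  by move=> y; rewrite pairE.
move=> d; rewrite !pairE -big_split; apply: eq_bigr => i _ /=.
by rewrite [X in _ + X]mulrC.
Qed.

(** Chain rule along the affine inclusion of the first factor, written as a linear map plus a
    constant. *)
Lemma D1E V W (f : V * W -> R^o) z v :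
  vdifferentiable f z -> D1 f z v = vdiff f z (v, 0).
Proof.
case: z => x y fz.
have il : linear (fun v : V => (v, 0) : V * W).
  by move=> k v1 v2; congr (_, _); rewrite /= scaler0 addr0.
have ix : is_vdiff (fun v : V => (v, y) : V * W) x (fun v => (v, 0)).
  by apply: is_vdiff_ext (is_vdiffD (is_vdiff_linear x il)
    (is_vdiff_cst (0, y) x)) => u;
    congr (_, _); rewrite /= ?addr0 ?add0r.
exact: (vdiff_val (is_vdiff_comp ix (is_vdiff_vdiff fz))).
Qed.

Lemma D2E V W (f : V * W -> R^o) z w :
  vdifferentiable f z -> D2 f z w = vdiff f z (0, w).
Proof.
case: z => x y fz.
have il : linear (fun w : W => (0, w) : V * W).
  by move=> k v1 v2; congr (_, _); rewrite /= scaler0 addr0.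
have iy : is_vdiff (fun w : W => (x, w) : V * W) y (fun w => (0, w)).
  by apply: is_vdiff_ext (is_vdiffD (is_vdiff_linear y il)
    (is_vdiff_cst (x, 0) y)) => u;
    congr (_, _); rewrite /= ?addr0 ?add0r.
exact: (vdiff_val (is_vdiff_comp iy (is_vdiff_vdiff fz))).
Qed.

Lemma vdiff_partials V W (f : V * W -> R^o) z v w :
  vdifferentiable f z -> vdiff f z (v, w) = D1 f z v + D2 f z w.
Proof.
move=> fz; rewrite D1E // D2E // -linearD; congr (vdiff f z _).
by congr (_, _); rewrite /= ?addr0 ?add0r.
Qed.

End Calculus.

(** * First variation of the common action *)

Section Action.
Variables (R : realType) (Q : vectType R) (N : nat).
Variables (s : R) (a b : 'I_N -> 'I_N.+1) (G : Q * covector Q -> R^o).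
Hypothesis G_diff : forall z, vdifferentiable G z.

Definition action (x : phase Q N) : R^o :=
  \sum_(k < N) (s * x.2 k (x.1 (a k)) - G (x.1 (b k), x.2 k)).

Lemma vdiff_action (x d : phase Q N) :
  vdiff action x d =
    \sum_(k < N) (s * d.2 k (x.1 (a k)) - D2 G (x.1 (b k), x.2 k) (d.2 k)) +
    \sum_(k < N) (s * x.2 k (d.1 (a k)) - D1 G (x.1 (b k), x.2 k) (d.1 (b k))).
Proof.
have l1 i : linear (fun y : phase Q N => y.1 i).
  by move=> k y z; rewrite /= !ffunE.
have l2 i : linear (fun y : phase Q N => y.2 i).
  by move=> k y z; rewrite /= !ffunE.
have lb k : linear (fun y : phase Q N => (y.1 (b k), y.2 k)).
  by move=> c y z; rewrite l1 l2.
have dG k : is_vdiff (fun y : phase Q N => G (y.1 (b k), y.2 k)) x _ :=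
  is_vdiff_comp (is_vdiff_linear x (lb k)) (is_vdiff_vdiff (G_diff _)).
rewrite (vdiff_val (is_vdiff_ext _ (fun=> erefl) (is_vdiff_sum (index_enum _)
  (fun k => is_vdiffD (is_vdiffZ s (is_vdiff_pairing x (l2 k) (l1 (a k))))
    (is_vdiffZ (-1) (dG k)))))).
  rewrite -big_split; apply: eq_bigr => k _ /=.
  rewrite vdiff_partials // [D1 _ _ _ + _]addrC.
  by rewrite scalerDr scaleN1r opprD addrACA.
by move=> y /=; apply: eq_bigr => k _; rewrite scaleN1r.
Qed.

Lemma momentum_stationary (x : phase Q N) (k : 'I_N) :
  (forall dp, vdiff action x (0, [ffun j => if j == k then dp else 0]) = 0) ->
  s *: ev (x.1 (a k)) = D2 G (x.1 (b k), x.2 k).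
Proof.
move=> stat; apply/lfunP => dp; apply/eqP; rewrite -subr_eq0; apply/eqP.
rewrite scale_lfunE evE -[RHS](stat dp) vdiff_action /=.
rewrite [X in _ = _ + X]big1 ?addr0.
  rewrite (bigD1 k) //= !ffunE eqxx big1 ?addr0 // => j /negPf jk.
  by rewrite !ffunE jk lfunE /= linear0 mulr0 subr0.
by move=> j _; rewrite !ffunE !linear0 ?mulr0 ?subr0 ?addr0.
Qed.

(** Injectivity of [a] and [b] leaves only the pairing of index [i] and the [G] term of index [j].
    Only the given [v] is tested, so that [v] may be confined to a fibre. *)
Lemma position_stationary (x : phase Q N) (i j : 'I_N) (v : Q) :
  injective a -> injective b -> a i = b j ->
  vdiff action x ([ffun k => if k == a i then v else 0], 0) = 0 ->
  s * x.2 i v = D1 G (x.1 (b j), x.2 j) v.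
Proof.
move=> a_inj b_inj aibj; rewrite vdiff_action /= big1 ?add0r; last first.
  by move=> k _; rewrite !ffunE lfunE /= linear0 mulr0 subr0.
rewrite big_split sumrN /= (bigD1 i) //= [X in _ - X](bigD1 j) //=.
rewrite !ffunE aibj !eqxx big1 => [|k ki]; last first.
  by rewrite ffunE -aibj (inj_eq a_inj) (negPf ki) linear0 mulr0.
rewrite big1 => [|k kj]; last first.
  by rewrite ffunE (inj_eq b_inj) (negPf kj) linear0.
by rewrite !addr0 => /eqP; rewrite subr_eq0 => /eqP.
Qed.

End Action.

(** * The two principles and their test variations *)

Lemma action_plusE (R : realType) (Q : vectType R) N
    (H : Q * covector Q -> R^o) :
  action_plus H = action 1 (@ord_next N) (@ord_this N) H.
Proof.
by apply/funext => x; apply: eq_bigr => k _; rewrite mul1r.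
Qed.

Lemma action_minusE (R : realType) (Q : vectType R) N
    (H : covector Q * Q -> R^o) :
  action_minus H =
    action (-1) (@ord_this N) (@ord_next N) (fun z => H (z.2, z.1)).
Proof.
by apply/funext => x; apply: eq_bigr => k _; rewrite mulN1r.
Qed.

Lemma vdifferentiable_swap (R : realType) (V W : vectType R)
    (f : V * W -> R^o) :
  (forall z, vdifferentiable f z) ->
  forall z, vdifferentiable (fun z : W * V => f (z.2, z.1) : R^o) z.
Proof.
move=> fd z; have sl : linear (fun z : W * V => (z.2, z.1)) by [].
by case: (is_vdiff_comp (is_vdiff_linear z sl) (is_vdiff_vdiff (fd _))).
Qed.

Lemma ord_this_inj N : injective (@ord_this N).
Proof. by move=> i j /(congr1 val) /= /val_inj. Qed.

Lemma ord_next_inj N : injective (@ord_next N).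
Proof. exact: lift_inj. Qed.

Section AdmissibleVariations.
Variables (R : realType) (Q : vectType R) (Delta : constraint_distribution Q).
Variables (N : nat) (q : nat -> Q).

Lemma admissible_momentum (d : {ffun 'I_N -> covector Q}) :
  admissible_variation Delta q ((0, d) : phase Q N).
Proof. by split=> [||k]; rewrite /= ffunE ?mem0v. Qed.

(** An interior index keeps both endpoints fixed, and zero lies in every other fibre. *)
Lemma admissible_position (i : 'I_N.+1) (v : Q) :
  i != ord0 -> i != ord_max -> v \in Delta (q i) ->
  admissible_variation Delta q
    (([ffun k => if k == i then v else 0], 0) : phase Q N).
Proof.
move=> i0 iN vi; split=> [||k] /=; rewrite ffunE; last first.
- by case: eqP => [->|_] //; rewrite mem0v.
- by rewrite eq_sym (negPf iN).
- by rewrite eq_sym (negPf i0).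
Qed.

End AdmissibleVariations.

Theorem proposition8p5 (R : realType) (Q : vectType R)
    (Delta : constraint_distribution Q) (Rt : retraction Q)
    (I : local_inverse Rt)
    (N : nat) (hN : (1 <= N)%N) :
  (forall (H : Q * covector Q -> R^o) (q : nat -> Q) (p : nat -> covector Q),
     smooth H ->
     Hamilton_dAlembert_plus Delta I N H q p ->
     (forall k, (k < N)%N ->
        Delta_plus Delta I (q k, q k.+1) /\
        ev (q k.+1) = D2 H (q k, p k.+1)) /\
     (forall k, (1 <= k < N)%N ->
        annihilator (Delta (q k)) (p k - D1 H (q k, p k.+1)))) /\
  (forall (H : covector Q * Q -> R^o) (q : nat -> Q) (p : nat -> covector Q),
     smooth H ->
     Hamilton_dAlembert_minus Delta I N H q p ->
     (forall k, (k < N)%N ->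
        Delta_minus Delta I (q k, q k.+1) /\
        ev (q k) = - D1 H (p k, q k.+1)) /\
     (forall k, (k.+1 < N)%N ->
        annihilator (Delta (q k.+1)) (p k.+1 + D2 H (p k, q k.+1)))).
Proof.
(* [Ck 1] supplies differentiability of the Hamiltonian at every point. *)
split=> H q p Hs; have Hd := (Hs 1%N).1.
  rewrite /Hamilton_dAlembert_plus action_plusE => -[constr stat].
  split=> [k kN|[//|k] /andP[_ kN]].
    split; first exact: constr.
    have := momentum_stationary Hd (k := Ordinal kN)
      (fun dp => stat _ (admissible_momentum _ _ _)).
    by rewrite scale1r !ffunE.
  (* The case split has shifted the index: the interior point is [q k.+1], paired in summand [k] and
     an argument of [H] in summand [k.+1]. *)
  move=> v vq; pose i := Ordinal (ltnW kN); pose j := Ordinal kN.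
  have nij : ord_next i = ord_this j by exact: val_inj.
  have adm := admissible_position (i := ord_next i) (v := v) _ _ vq.
  have := position_stationary Hd (@ord_next_inj N) (@ord_this_inj N) nij
    (stat _ (adm _ _)).
  rewrite !ffunE mul1r add_lfunE opp_lfunE => -> //; first exact: subrr.
  by rewrite -val_eqE /= /bump /= neq_ltn add1n kN.
rewrite /Hamilton_dAlembert_minus action_minusE => -[constr stat].
have Gd := vdifferentiable_swap Hd.
split=> k kN.
  split; first exact: constr.
  (* For the Hamiltonian with exchanged arguments, [D2] is [D1 H] by conversion, and below [D1] is
     [D2 H]. *)
  have := momentum_stationary Gd (k := Ordinal kN)
    (fun dp => stat _ (admissible_momentum _ _ _)).
  by rewrite !ffunE scaleN1r => /(canRL (@opprK _)).
(* The roles are reversed: [q k.+1] is paired in summand [k.+1] and enters [H] in summand [k]. *)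
move=> v vq; pose i := Ordinal kN; pose j := Ordinal (ltnW kN).
have tij : ord_this i = ord_next j by exact: val_inj.
have adm := admissible_position (i := ord_this i) (v := v) _ _ vq.
have := position_stationary Gd (@ord_this_inj N) (@ord_next_inj N) tij
  (stat _ (adm _ _)).
rewrite !ffunE mulN1r add_lfunE => pD.
rewrite -[D2 _ _ _]pD // ?subrr //.
by rewrite -val_eqE /= neq_ltn kN.
Qed.
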